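(* Let $\Omega\subseteq\mathbb{R}^n$ be open, let $u\in\mathcal{E}^C(\Omega)$ and let $\mathcal{J}:=\{I_0^{\mathrm{d}}(\Omega)\}$. Then: (i) $u\in\mathcal{E}_M^C(\Omega)$ if and only if $\forall K\Subset\Omega\ \forall\alpha\in\mathbb{N}^n\ \exists N\in\mathbb{N}:\ \sup_{x\in K}|\partial^\alpha u_\varepsilon(x)|=O_{\mathcal{J}}(\underline{\varepsilon}^{-N})$ as $\varepsilon\in\mathbb{I}^{\mathrm{d}}(\Omega)$; (ii) if $u\in\mathcal{E}_M^C(\Omega)$, then $u\in\mathcal{N}^C(\Omega)$ if and only if $\forall K\Subset\Omega\ \forall\alpha\in\mathbb{N}^n\ \forall m\in\mathbb{N}:\ \sup_{x\in K}|\partial^\alpha u_\varepsilon(x)|=O(\underline{\varepsilon}^{m})$ as $\varepsilon\in\mathbb{I}^{\mathrm{d}}(\Omega)$.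
   Context: $\mathbb{N}=\{0,1,2,\dots\}$, $n\ge1$; $K\Subset\Omega$ means $K$ is a compact subset of $\Omega$. For $\varphi\in\mathcal{D}(\mathbb{R}^n)$, $r>0$: $(r\odot\varphi)(y):=r^{-n}\varphi(y/r)$. $\mathcal{A}_0:=\{\varphi\in\mathcal{D}(\mathbb{R}^n)\mid\int\varphi=1\}$, $\mathcal{A}_q:=\{\varphi\in\mathcal{A}_0\mid\int x^\alpha\varphi(x)\,dx=0\ \forall\, 1\le|\alpha|\le q\}$. $U(\Omega):=\{(\varphi,x)\in\mathcal{A}_0\times\Omega\mid\mathrm{supp}(\varphi)\subseteq\Omega-x\}$. Smoothness: smoothness for the infinite-dimensional spaces is in the usual diffeological/convenient sense. A map $p$ from $(0,1]\times\Omega$, or from an open subset of some $\mathbb{R}^k$, into $\mathcal{A}_q$ is smooth iff $(t,y)\mapsto p(t)(y)$ is smooth and, locally in $t$, the supports of $p(t)$ lie in a common compact set. A function $R:U(\Omega)\to\mathbb{R}$ is smooth iff $R\circ p$ is smooth for every smooth map $p$ from an open subset of some $\mathbb{R}^k$ into $U(\Omega)\subseteq\mathcal{A}_0\times\Omega$. $\mathcal{E}^C(\Omega):=\mathcal{C}^\infty(U(\Omega),\mathbb{R})$. $\mathcal{C}^\infty_{\mathrm{b}}((0,1]\times\Omega,\mathcal{A}_q)$ is the set of $\varphi\in\mathcal{C}^\infty((0,1]\times\Omega,\mathcal{A}_q)$ such that for every $K\Subset\Omega$ there is a bounded $B\subseteq\mathbb{R}^n$ with $\mathrm{supp}[\partial^\alpha\varphi(r,x)]\subseteq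 B$ for all $\alpha\in\mathbb{N}^n$, $r\in(0,1]$, $x\in K$. It is identified with $\mathcal{C}^\infty_{\mathrm{b}}((0,1],\mathcal{C}^\infty(\Omega,\mathcal{A}_q))$ (smooth maps $r\mapsto\varphi_r\in\mathcal{C}^\infty(\Omega,\mathcal{A}_q)$ with the same boundedness condition) via $\varphi_r(x)=\varphi(r,x)$. $R\in\mathcal{E}^C_M(\Omega)$ iff $R\in\mathcal{E}^C(\Omega)$ and $\forall K\Subset\Omega\,\forall\alpha\in\mathbb{N}^n\,\exists N\in\mathbb{N}\,\forall\varphi\in\mathcal{C}^\infty_{\mathrm{b}}((0,1]\times\Omega,\mathcal{A}_0)$: $\sup_{x\in K}|\partial_x^\alpha R(r\odot\varphi(r,x),x)|=O(r^{-N})$ as $r\to0^+$. $R\in\mathcal{N}^C(\Omega)$ iff $R\in\mathcal{E}^C_M(\Omega)$ and $\forall K\Subset\Omega\,\forall\alpha\in\mathbb{N}^n\,\forall m\in\mathbb{N}\,\exists q\in\mathbb{N}\,\forall\varphi\in\mathcal{C}^\infty_{\mathrm{b}}((0,1]\times\Omega,\mathcal{A}_q)$: $\sup_{x\in K}|\partial_x^\alpha R(r\odot\varphi(r,x),x)|=O(r^{m})$ as $r\to0^+$. Index structure: $I_q^{\mathrm{d}}(\Omega):=(0,1]\times\mathcal{C}^\infty_{\mathrm{b}}((0,1],\mathcal{C}^\infty(\Omega,\mathcal{A}_q))$; $\mathbb{I}^{\mathrm{d}}(\Omega)=(I^{\mathrm{d}}(\Omega),\le,\mathcal{I}^{\mathrm{d}}(\Omega))$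 with $I^{\mathrm{d}}(\Omega):=I_0^{\mathrm{d}}(\Omega)$, $\mathcal{I}^{\mathrm{d}}(\Omega):=\{I_q^{\mathrm{d}}(\Omega)\mid q\in\mathbb{N}\}$, and $(r,\varphi)\le(s,\psi)$ iff $\varphi=\psi$ and $r\le s$. For $\varepsilon=(r,\varphi)\in I^{\mathrm{d}}(\Omega)$: $\underline\varepsilon:=r$, $\mathrm{ev}_\varepsilon(x):=(r\odot\varphi_r(x),x)$ and $u_\varepsilon:=u\circ\mathrm{ev}_\varepsilon$ for $u\in\mathcal{E}^C(\Omega)$. Big-O: put $A_{\le e}:=\{\varepsilon\in A\mid\varepsilon\le e\}$. For a nonempty $\mathcal{J}\subseteq\mathcal{I}^{\mathrm{d}}(\Omega)$, $x_\varepsilon=O_{\mathcal{J}}(y_\varepsilon)$ means: there is $A\in\mathcal{J}$ such that for all $a\in A$ there are $H>0$ and $\varepsilon_0\in A_{\le a}$ with $|x_\varepsilon|\le H|y_\varepsilon|$ for all $\varepsilon\in A_{\le\varepsilon_0}$. $O$ without subscript is $O_{\mathcal{J}}$ with $\mathcal{J}=\mathcal{I}^{\mathrm{d}}(\Omega)$. Convention: for given $K\Subset\Omega$ and $\varphi$, $(r\odot\varphi_r(x),x)\in U(\Omega)$ for all $x$ in a neighbourhood of $K$ once $r$ is small enough; the expressions above are considered for such $r$ only, and the values assigned to the suprema for other $r$ are irrelevant. *)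

(* Defs.v *)
From HB Require Import structures.
From mathcomp Require Import all_boot all_order all_algebra.
From mathcomp Require Import all_classical all_reals all_analysis.

Set Implicit Arguments.
Unset Strict Implicit.
Unset Printing Implicit Defensive.
Import Order.TTheory GRing.Theory Num.Theory.
Import numFieldNormedType.Exports.

Local Open Scope classical_set_scope.
Local Open Scope ring_scope.

(* The library has Lebesgue measure on R only; on R^n we take its n-fold power,
   on [n.-tuple T] with the product sigma-algebra, obtained by iterating the
   binary product of sigma-finite measures. *)
Section power_measure.
Context d (T : measurableType d) (R : realType).
Variable m : {sigma_finite_measure set T -> \bar R}.

Definition tuple_cons (n : nat) (p : T * n.-tuple T) : n.+1.-tuple T :=
  [the n.+1.-tuple T of p.1 :: p.2].

Definition tuple_uncons (n : nat) (t : n.+1.-tuple T) : T * n.-tuple T :=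
  (tnth t ord0, [tuple of behead t]).

Let measurable_tuple_cons n : measurable_fun setT (@tuple_cons n).
Proof. exact: measurable_cons. Qed.

Let measurable_tuple_uncons n : measurable_fun setT (@tuple_uncons n).
Proof.
apply/measurable_fun_pairP; split => /=.
  exact: measurable_tnth.
exact: measurable_behead.
Qed.

Let tuple_consK n : cancel (@tuple_cons n) (@tuple_uncons n).
Proof.
by move=> [a t]; congr pair; exact: val_inj.
Qed.

Section cons_measure.
Variables (n : nat) (mu : {sigma_finite_measure set (n.-tuple T) -> \bar R}).

Definition cons_measure : set (n.+1.-tuple T) -> \bar R :=
  pushforward (m \x mu)%E (@tuple_cons n).

Let mpre (A : set (n.+1.-tuple T)) :
  measurable A -> measurable (@tuple_cons n @^-1` A).
Proof. by move=> mA; rewrite -[X in measurable X]setTI; exact: measurable_tuple_cons. Qed.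

Let cons_measure0 : cons_measure set0 = 0%E.
Proof. by rewrite /cons_measure /pushforward preimage_set0 measure0. Qed.

Let cons_measure_ge0 A : (0 <= cons_measure A)%E.
Proof. exact: (@measure_ge0 _ _ _ (m \x mu)%E). Qed.

Let cons_measure_sigma_additive : semi_sigma_additive cons_measure.
Proof.
move=> F mF tF mUF; rewrite /cons_measure /pushforward preimage_bigcup.
apply: measure_semi_sigma_additive.
- by move=> k; exact: mpre.
- apply/trivIsetP => /= i j _ _ ij; rewrite -preimage_setI.
  by move/trivIsetP : tF => /(_ _ _ _ _ ij) ->//; rewrite preimage_set0.
- by rewrite -preimage_bigcup; exact: mpre.
Qed.

HB.instance Definition _ := isMeasure.Build _ _ _ cons_measure
  cons_measure0 cons_measure_ge0 cons_measure_sigma_additive.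

Let cons_measure_sigma_finite : sigma_finite setT cons_measure.
Proof.
have /sigma_finiteP[F [TF ndF Foo]] := sigma_finiteT m.
have /sigma_finiteP[G [TG ndG Goo]] := sigma_finiteT mu.
exists (fun k => @tuple_uncons n @^-1` (F k `*` G k)).
  apply/esym/seteqP; split => // t _.
  have [i _ Fi] : (\bigcup_k F k) (tuple_uncons t).1 by rewrite -TF.
  have [j _ Gj] : (\bigcup_k G k) (tuple_uncons t).2 by rewrite -TG.
  exists (maxn i j) => //; split => /=.
    by move: Fi; exact/subsetPset/ndF/leq_maxl.
  by move: Gj; exact/subsetPset/ndG/leq_maxr.
move=> k; have [mF Fk] := Foo k; have [mG Gk] := Goo k; split.
  rewrite -[X in measurable X]setTI; apply: measurable_tuple_uncons => //.
  exact: measurableX.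
rewrite /cons_measure /pushforward (_ : _ @^-1` _ = F k `*` G k).
  by rewrite product_measure1E// lte_mul_pinfty// ge0_fin_numE.
have -> : @tuple_cons n @^-1` (@tuple_uncons n @^-1` (F k `*` G k)) =
    (fun x => tuple_uncons (tuple_cons x)) @^-1` (F k `*` G k) by [].
by apply/seteqP; split => x; rewrite /preimage /mkset tuple_consK.
Qed.

HB.instance Definition _ := Measure_isSigmaFinite.Build _ _ _ cons_measure
  cons_measure_sigma_finite.

End cons_measure.

Fixpoint power_measure (n : nat) :
    {sigma_finite_measure set (n.-tuple T) -> \bar R} :=
  if n is k.+1 then cons_measure (power_measure k)
  else \d_([tuple] : 0.-tuple T).

End power_measure.

Definition integral_rV (R : realType) (n : nat) (f : 'rV[R]_n -> R) : R :=
  \int[power_measure (@lebesgue_measure R) n]_t f (\row_i tnth t i).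

Section smoothness.
Context (R : realType).

(* [smooth_open D f] is meant for finite-dimensional [V] and open [D]: f is
   C^oo on D iff all its iterated directional derivatives, in arbitrary
   directions, are Frechet differentiable on D. *)
Definition smooth_open (V W : normedModType R) (D : set V) (f : V -> W) : Prop :=
  forall (s : seq V) (x : V), D x ->
    differentiable (foldr (fun v g => fun y => 'D_v g y) f s) x.

(* Smoothness on an arbitrary subset, such as ]0, 1] `*` Omega: f coincides,
   locally in D, with functions that are smooth on open sets.  Only the values
   of f on D matter. *)
Definition smooth_on (V W : normedModType R) (D : set V) (f : V -> W) : Prop :=
  forall x, D x -> exists (O : set V) (g : V -> W),
    [/\ open O, O x, smooth_open O g & {in O `&` D, g =1 f}].

(* D_0^{alpha_0} ... D_{n-1}^{alpha_{n-1}} f *)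
Definition partial (n : nat) (alpha : 'I_n -> nat) (f : 'rV[R]_n -> R) :
    'rV[R]_n -> R :=
  foldr (fun i g => iter (alpha i) (fun h => fun x => 'D_(delta_mx 0 i) h x) g)
    f (enum 'I_n).

Definition supp (n : nat) (f : 'rV[R]_n -> R) : set 'rV[R]_n :=
  closure [set x | f x != 0].

Definition test_function (n : nat) : set ('rV[R]_n -> R) :=
  [set f | smooth_on setT f /\ compact (supp f)].

End smoothness.

Section colombeau.
Context (R : realType) (n : nat).
Local Notation E := 'rV[R]_n.

Definition dilate (r : R) (phi : E -> R) : E -> R :=
  fun y => r ^- n * phi (r^-1 *: y).

Definition monomial (alpha : 'I_n -> nat) (x : E) : R :=
  \prod_i x 0 i ^+ alpha i.

(* For q = 0 the moment condition is void. *)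
Definition calA (q : nat) : set (E -> R) :=
  [set phi | [/\ test_function phi, integral_rV phi = 1 &
    forall alpha : 'I_n -> nat, (1 <= \sum_i alpha i <= q)%N ->
      integral_rV (fun x => monomial alpha x * phi x) = 0]].

Definition calU (Omega : set E) : set ((E -> R) * E) :=
  [set p | [/\ calA 0 p.1, Omega p.2 & forall y, supp p.1 y -> Omega (y + p.2)]].

Definition smooth_into_A (V : normedModType R) (D : set V) (q : nat)
    (p : V -> E -> R) : Prop :=
  [/\ forall t, D t -> calA q (p t),
      smooth_on (D `*` setT) (fun ty : V * E => p ty.1 ty.2) &
      forall t, D t -> exists (O : set V) (L : set E),
        [/\ open O, O t, compact L &
            forall s, O s -> D s -> supp (p s) `<=` L]].

Definition plot (Omega : set E) (k : nat) (D : set 'rV[R]_k)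
    (p : 'rV[R]_k -> (E -> R) * E) : Prop :=
  [/\ open D, forall t, D t -> calU Omega (p t),
      smooth_into_A D 0 (fun t => (p t).1) &
      smooth_on D (fun t => (p t).2)].

(* Functions on U(Omega) are represented by total functions whose values
   outside U(Omega) are immaterial. *)
Definition EC (Omega : set E) : set ((E -> R) * E -> R) :=
  [set u : (E -> R) * E -> R | forall (k : nat) (D : set 'rV[R]_k) (p : 'rV[R]_k -> (E -> R) * E),
    plot Omega D p -> smooth_on D (u \o p)].

Definition compact_in (K Omega : set E) : Prop := compact K /\ K `<=` Omega.

(* phi(r, x) is the function [phi (r, x) : E -> R]; the derivative
   D^alpha phi(r, x) is taken in x, pointwise in the argument y of phi(r, x). *)
Definition Cb (Omega : set E) (q : nat) : set (R * E -> E -> R) :=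
  [set phi : R * E -> E -> R |
    smooth_into_A ([set r : R | 0 < r <= 1] `*` Omega) q phi /\
    forall K, compact_in K Omega -> exists2 B : set E, bounded_set B &
      forall (alpha : 'I_n -> nat) (r : R) (x : E), 0 < r <= 1 -> K x ->
        supp (fun y => partial alpha (fun x' => phi (r, x') y) x) `<=` B].

(* The supremum of |f| over K, in [0, +oo]; it is 0 if K is empty. *)
Definition sup_abs (K : set E) (f : E -> R) : \bar R :=
  ereal_sup (0%E |` [set `|f x|%:E | x in K]).

(* x_r = O(y_r) as r -> 0+. *)
Definition bigO_right0 (x : R -> \bar R) (y : R -> R) : Prop :=
  exists2 H : R, 0 < H & \forall r \near 0^'+, (`|x r| <= (H * `|y r|)%:E)%E.

Definition eval_at (u : (E -> R) * E -> R) (phi : R * E -> E -> R) (r : R) :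
    E -> R :=
  fun x => u (dilate r (phi (r, x)), x).

Definition ECM (Omega : set E) : set ((E -> R) * E -> R) :=
  [set u : (E -> R) * E -> R | EC Omega u /\
    forall K, compact_in K Omega -> forall alpha : 'I_n -> nat,
    exists N : nat, forall phi, Cb Omega 0 phi ->
      bigO_right0 (fun r => sup_abs K (partial alpha (eval_at u phi r)))
                  (fun r => r ^- N)].

Definition NC (Omega : set E) : set ((E -> R) * E -> R) :=
  [set u : (E -> R) * E -> R | ECM Omega u /\
    forall K, compact_in K Omega -> forall (alpha : 'I_n -> nat) (m : nat),
    exists q : nat, forall phi, Cb Omega q phi ->
      bigO_right0 (fun r => sup_abs K (partial alpha (eval_at u phi r)))
                  (fun r => r ^+ m)].

(* A pair (r, phi), with phi a family of maps phi_s : Omega -> A_0, s in ]0,1]. *)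
Definition index_d : Type := (R * (R -> E -> E -> R))%type.

(* C^oo_b(]0, 1], C^oo(Omega, A_q)), through phi_r(x) = phi(r, x). *)
Definition Cb_curried (Omega : set E) (q : nat) : set (R -> E -> E -> R) :=
  [set phi | Cb Omega q (fun rx => phi rx.1 rx.2)].

Definition I_d (Omega : set E) (q : nat) : set index_d :=
  [set e | 0 < e.1 <= 1 /\ Cb_curried Omega q e.2].

Definition calI_d (Omega : set E) : set (set index_d) := range (I_d Omega).

(* phi = psi means equality of maps on ]0, 1] `*` Omega, since the values of the
   representing total functions elsewhere are immaterial. *)
Definition index_le (Omega : set E) (e e' : index_d) : Prop :=
  (forall s x, 0 < s <= 1 -> Omega x -> e.2 s x = e'.2 s x) /\ e.1 <= e'.1.

Definition ev (e : index_d) (x : E) : (E -> R) * E := (dilate e.1 (e.2 e.1 x), x).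

Definition at_index (u : (E -> R) * E -> R) (e : index_d) : E -> R := u \o ev e.

End colombeau.

(* x_e = O_J(y_e) for nets indexed by a type I preordered by le, where J is a
   nonempty set of subsets of I. *)
Definition bigO_index (R : realType) (I : Type) (le : I -> I -> Prop)
    (J : set (set I)) (x : I -> \bar R) (y : I -> R) : Prop :=
  exists2 S : set I, J S & forall a, S a -> exists (H : R) (e0 : I),
    [/\ 0 < H, S e0, le e0 a &
        forall e, S e -> le e e0 -> (`|x e| <= (H * `|y e|)%:E)%E].

(* Main.v *)
Require Import Defs.
From mathcomp Require Import all_boot all_order all_algebra.
From mathcomp Require Import all_classical all_reals all_analysis.
Set Implicit Arguments.
Unset Strict Implicit.
Unset Printing Implicit Defensive.
Import Order.TTheory GRing.Theory Num.Theory.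
Import numFieldNormedType.Exports.
Local Open Scope classical_set_scope.
Local Open Scope ring_scope.

(** An index of [I_d Omega q] is a scale together with a family, and its
    predecessors are the pairs with a smaller scale and the same family.  Below
    a given index the order is therefore a copy of an interval [0 < r <= r0],
    and quantifying over the indices of [I_d Omega q] amounts to quantifying over
    the families in [Cb Omega q]: an estimate that holds eventually below every
    index of [I_d Omega q] is an estimate as [r -> 0+] for every family
    ([bigO_below_indices]).

    Both equivalences follow by choosing [q].  For moderateness [q = 0] on both
    sides.  For negligibility the existential quantifier over [q] is the choice
    of a member of [calI_d Omega] in the definition of big-O.  In both cases the
    quantifiers then stand in the same order on the two sides.

    The one point that needs an argument is that the order identifies families
    that agree on ]0, 1] x Omega only.  This is harmless because [Omega] is open:
    derivatives at points of [K], a subset of [Omega], depend on the values in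
    [Omega] only ([partial_local]). *)

Lemma derive_local (R : realType) (V : normedModType R) (D : set V)
    (f g : V -> R) (v : V) :
  open D -> {in D, f =1 g} -> {in D, 'D_v f =1 'D_v g}.
Proof.
move=> oD fg x xD; have Dx : D x by exact: set_mem.
(* [near_eq_derive] requires a nonzero direction. *)
have [->|v0] := eqVneq v 0; first by rewrite !derive0.
apply: near_eq_derive => //; apply: filterS (open_nbhs_nbhs (conj oD Dx)) => y Dy.
by apply: fg; exact: mem_set.
Qed.

Lemma partial_local (R : realType) (n : nat) (D : set 'rV[R]_n)
    (alpha : 'I_n -> nat) (f g : 'rV[R]_n -> R) :
  open D -> {in D, f =1 g} -> {in D, partial alpha f =1 partial alpha g}.
Proof.
move=> oD fg; rewrite /partial; elim: (enum 'I_n) => [//|i s IHs] /=.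
by elim: (alpha i) => [//|k IHk] /=; exact: derive_local.
Qed.

Lemma eq_sup_abs (R : realType) (n : nat) (K : set 'rV[R]_n)
    (f g : 'rV[R]_n -> R) :
  {in K, f =1 g} -> sup_abs K f = sup_abs K g.
Proof.
move=> fg; rewrite /sup_abs; congr (ereal_sup (_ `|` _)).
by apply: eq_imagel => x Kx; rewrite fg//; exact: mem_set.
Qed.

(** The total function [phi] represents the same family as [e.2], but may differ
    from it outside ]0, 1] x Omega; the suprema over [K] do not see this, as
    [K] has the neighbourhood [Omega]. *)
Lemma sup_partial_at_index (R : realType) (n : nat) (Omega K : set 'rV[R]_n)
    (u : ('rV[R]_n -> R) * 'rV[R]_n -> R) (alpha : 'I_n -> nat)
    (e : index_d R n) (phi : R * 'rV[R]_n -> 'rV[R]_n -> R) :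
  open Omega -> K `<=` Omega -> 0 < e.1 <= 1 ->
  (forall s x, 0 < s <= 1 -> Omega x -> e.2 s x = phi (s, x)) ->
  sup_abs K (partial alpha (at_index u e)) =
  sup_abs K (partial alpha (eval_at u phi e.1)).
Proof.
move=> oO KO e01 ephi; apply: eq_sup_abs => x /set_mem/KO Ox.
apply: (partial_local alpha oO _ (mem_set Ox)) => y /set_mem Oy.
by rewrite /at_index /ev /eval_at /= ephi.
Qed.

(** Below the index [(r0, phi)] lie exactly the [(r, phi)] with [r <= r0], so
    the two sides translate into each other: a right neighbourhood ]0, d[ of 0
    gives the index [(min (d / 2) r0, phi)], and conversely the family [phi] is
    tested at the index [(1, phi)]. *)
Lemma bigO_below_indices (R : realType) (n : nat) (Omega K : set 'rV[R]_n)
    (u : ('rV[R]_n -> R) * 'rV[R]_n -> R) (alpha : 'I_n -> nat) (q : nat)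
    (y : R -> R) :
  open Omega -> K `<=` Omega ->
  (forall phi, Cb Omega q phi ->
     bigO_right0 (fun r => sup_abs K (partial alpha (eval_at u phi r))) y) <->
  bigO_index (index_le Omega) [set I_d Omega q]
    (fun e => sup_abs K (partial alpha (at_index u e))) (fun e => y e.1).
Proof.
move=> oO KO; split=> [bd | [_ -> bd] phi Cphi].
  exists (I_d Omega q); first by [].
  move=> [r0 phi] [/= /andP[r00 r01] Cphi].
  have [H H0 [d /= d0 Hd]] := bd _ Cphi.
  have m0 : 0 < Num.min (d / 2) r0 by rewrite lt_min r00 divr_gt0.
  exists H, (Num.min (d / 2) r0, phi); split => //.
  - split => //=; rewrite m0 (le_trans _ r01)//.
    by rewrite ge_min lexx orbT.
  - by split => //=; rewrite ge_min lexx orbT.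
  move=> e [e01 _] [/= ephi le_e]; have /andP[e0 _] := e01.
  rewrite (@sup_partial_at_index _ _ _ _ _ _ _ (fun rx => phi rx.1 rx.2) oO KO)//.
  apply: Hd => //=; rewrite sub0r normrN gtr0_norm//.
  apply: (@le_lt_trans _ _ (d / 2)); first by rewrite (le_trans le_e)// ge_min lexx.
  by rewrite ltr_pdivrMr// ltr_pMr// ltr1n.
pose psi s x := phi (s, x).
have Cpsi : Cb_curried Omega q psi.
  by rewrite /Cb_curried /mkset (_ : (fun rx => _) = phi)//; apply/funext => -[].
have I1 : I_d Omega q (1, psi) by split => //=; rewrite ltr01 lexx.
have [H [e0 [H0 [/andP[e00 e01] _] [/= e0phi _] bnd]]] := bd _ I1.
exists H => //; near=> r.
have r0 : 0 < r by [].
have re0 : r <= e0.1 by near: r; exact: nbhs_right_le.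
apply: (bnd (r, psi)).
  by split => //=; rewrite r0 (le_trans re0).
by split => //= s x s01 Ox; rewrite e0phi.
Unshelve. all: by end_near. Qed.

Theorem theorem34 (R : realType) (n : nat) (n_ge1 : (1 <= n)%N)
    (Omega : set 'rV[R]_n) (openOmega : open Omega)
    (u : ('rV[R]_n -> R) * 'rV[R]_n -> R) (u_EC : EC Omega u) :
  (ECM Omega u <->
    forall K, compact_in K Omega -> forall alpha : 'I_n -> nat,
    exists N : nat,
      bigO_index (index_le Omega) [set I_d Omega 0]
        (fun e => sup_abs K (partial alpha (at_index u e)))
        (fun e => e.1 ^- N)) /\
  (ECM Omega u ->
    (NC Omega u <->
      forall K, compact_in K Omega -> forall (alpha : 'I_n -> nat) (m : nat),
        bigO_index (index_le Omega) (calI_d Omega)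
          (fun e => sup_abs K (partial alpha (at_index u e)))
          (fun e => e.1 ^+ m))).
Proof.
split; [split=> [[_ mod]|mod] | move=> u_ECM; split=> [[_ neg]|neg]].
- move=> K KO alpha; have [N bnd] := mod K KO alpha; exists N.
  by apply/(@bigO_below_indices _ _ _ _ _ _ _ (fun r => r ^- N)) => //; case: KO.
- split=> // K KO alpha; have [N bnd] := mod K KO alpha; exists N.
  by apply/(@bigO_below_indices _ _ _ _ _ _ _ (fun r => r ^- N)) => //; case: KO.
- move=> K KO alpha m; have [q bnd] := neg K KO alpha m.
  have [_ -> below] := (@bigO_below_indices _ _ _ _ _ _ _ (fun r => r ^+ m)
    openOmega (proj2 KO)).1 bnd.
  by exists (I_d Omega q) => //; exists q.
- split=> // K KO alpha m; have [_ [q _ <-] bnd] := neg K KO alpha m.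
  exists q; apply/(@bigO_below_indices _ _ _ _ _ _ _ (fun r => r ^+ m)) => //.
    by case: KO.
  by exists (I_d Omega q).
Qed.
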